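(* Let $M$ be a model of ZFA with set of atoms $A$, let $\Sigma\in M$ be a group of bijections of $A$, let $\mathcal{F}\in M$ be a normal filter of subgroups of $\Sigma$, and let $M'=M/\mathcal{F}$ be the resulting permutation model. Let $\Gamma$ be a group in $M'$. Suppose that for every $F\in\mathcal{F}$ with $F\subseteq\operatorname{Stab}(\Gamma)$ there is $\pi\in F\cap M'$ such that the action of $\pi$ on $\Gamma$ (that is, the automorphism $\gamma\mapsto\pi[\gamma]$ of $\Gamma$) is not an inner automorphism of $\Gamma$. Then $\Gamma$ is not the automorphism group of any graph in $M'$; that is, there is no graph $G\in M'$ such that $M'\models \Gamma\cong\operatorname{Aut}(G)$.
   Context: ZFA is ZF modified to allow a set $A$ of atoms (objects with no elements, distinct from each other and from $\varnothing$; extensionality is restricted to non-atoms). A bijection $\pi$ of $A$ acts on the whole universe by its given action on atoms and, recursively, $\pi[S]=\{\pi[x]\mid x\in S\}$ for sets $S$. Let $\Sigma$ be a group of bijections of $A$ in $M$. For $S\in M$, $\operatorname{Stab}(S)=\{\sigma\in\Sigma\mid \sigma[S]=S\}$; for a structure such as a group $\Gamma$, $\operatorname{Stab}(\Gamma)$ is the stabilizer of $\Gamma$ together with its group operation. A normal filter $\mathcal{F}$ of subgroups of $\Sigma$ is a family of subgroups of $\Sigma$ that is upwards closed (among subgroups) and closed under finite intersections, satisfies $\sigma\Psi\sigma^{-1}\in\mathcal{F}$ whenever $\Psi\in\mathcal{F}$ and $\sigma\in\Sigma$, and contains $\operatorname{Stab}(a)$ for each $a\in A$. An $S\in M$ is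 symmetric if $\operatorname{Stab}(S)\in\mathcal{F}$, and hereditarily symmetric if $S$ and every element of its transitive closure are symmetric. The permutation model $M'=M/\mathcal{F}$ is the class of hereditarily symmetric elements of $M$; it is a model of ZFA with the same set of atoms. A graph is a pair $\langle V(G),E(G)\rangle$ with $V(G)$ a set and $E(G)\subseteq V(G)^2$ symmetric and irreflexive; its automorphisms are the bijections of $V(G)$ preserving edges and non-edges. All notions ''in $M'$'' (graphs, automorphism groups, isomorphisms) are computed inside $M'$. *)

(* Defs.v *)
(* Models of ZFA are arbitrary structures for the language {mem, atom}, and
   set-theoretic notions are predicates that can be read in any such structure,
   in particular in a permutation model. *)

Set Implicit Arguments.
Unset Strict Implicit.

Record set_structure : Type := SetStructure {
  carrier :> Type;
  mem : carrier -> carrier -> Prop;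
  atom : carrier -> Prop
}.
Arguments mem {_} _ _.
Arguments atom {_} _.

Notation "x ∈ y" := (mem x y) (at level 70, no associativity).

(* First-order formulas with de Bruijn variables; they are only needed for the
   separation and replacement schemes. *)
Inductive formula : Type :=
| fMem (i j : nat)
| fEq (i j : nat)
| fAtom (i : nat)
| fFalse
| fImp (p q : formula)
| fAnd (p q : formula)
| fOr (p q : formula)
| fAll (p : formula)
| fEx (p : formula).

Definition scons (T : Type) (x : T) (e : nat -> T) (n : nat) : T :=
  match n with O => x | S k => e k end.

Fixpoint sat (M : set_structure) (e : nat -> M) (p : formula) : Prop :=
  match p with
  | fMem i j => e i ∈ e j
  | fEq i j => e i = e j
  | fAtom i => atom (e i)
  | fFalse => False
  | fImp p q => sat e p -> sat e q
  | fAnd p q => sat e p /\ sat e q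
  | fOr p q => sat e p \/ sat e q
  | fAll p => forall x : M, sat (scons x e) p
  | fEx p => exists x : M, sat (scons x e) p
  end.

Section Vocabulary.
Variable M : set_structure.
Implicit Types x y z p q f g h : M.

Definition isset x : Prop := ~ atom x.

Definition subset x y : Prop := forall z, z ∈ x -> z ∈ y.

Definition transitive x : Prop := forall y, y ∈ x -> subset y x.

Definition is_upair p x y : Prop :=
  isset p /\ forall z, z ∈ p <-> z = x \/ z = y.

(* Kuratowski pairs: p = {{x}, {x, y}}. *)
Definition is_opair p x y : Prop :=
  exists a b, is_upair a x x /\ is_upair b x y /\ is_upair p a b.

(* p = ((x, y), z). *)
Definition is_triple p x y z : Prop :=
  exists q, is_opair q x y /\ is_opair p q z.

Definition rel r x y : Prop := exists p, p ∈ r /\ is_opair p x y.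

Definition is_function f (X : M) : Prop :=
  isset f /\
  (forall p, p ∈ f -> exists x y, x ∈ X /\ is_opair p x y) /\
  (forall x, x ∈ X -> exists! y, rel f x y).

Definition is_bijection f (X Y : M) : Prop :=
  is_function f X /\
  (forall x y, rel f x y -> y ∈ Y) /\
  (forall y, y ∈ Y -> exists! x, rel f x y).

Definition is_id f (X : M) : Prop := forall x y, rel f x y <-> x ∈ X /\ x = y.

Definition is_inverse h f : Prop := forall x y, rel h x y <-> rel f y x.

(* h is the composite "f after g". *)
Definition is_comp h f g : Prop :=
  forall x z, rel h x z <-> exists y, rel g x y /\ rel f y z.

Definition is_tc (T x : M) : Prop :=
  isset T /\ transitive T /\ subset x T /\
  (forall U, isset U -> transitive U -> subset x U -> subset T U).

Definition is_atom_set (A : M) : Prop :=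
  isset A /\ forall x, x ∈ A <-> atom x.

Record is_ZFA : Prop := {
  zfa_atoms : exists A, is_atom_set A;
  zfa_atom_no_elements : forall x, atom x -> forall z, ~ z ∈ x;
  zfa_extensionality : forall x y, isset x -> isset y ->
    (forall z, z ∈ x <-> z ∈ y) -> x = y;
  zfa_empty : exists x, isset x /\ forall z, ~ z ∈ x;
  zfa_pairing : forall x y, exists p, is_upair p x y;
  zfa_union : forall x, exists y, isset y /\
    forall z, z ∈ y <-> exists u, u ∈ x /\ z ∈ u;
  zfa_power : forall x, exists y, isset y /\
    forall z, z ∈ y <-> isset z /\ subset z x;
  zfa_infinity : exists w, isset w /\
    (exists o, o ∈ w /\ isset o /\ forall z, ~ z ∈ o) /\
    (forall n, n ∈ w -> exists s, s ∈ w /\ isset s /\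
       forall z, z ∈ s <-> z ∈ n \/ z = n);
  zfa_separation : forall (phi : formula) (e : nat -> M) x,
    exists y, isset y /\
      forall z, z ∈ y <-> z ∈ x /\ sat (scons z e) phi;
  zfa_replacement : forall (phi : formula) (e : nat -> M) x,
    (forall u v v', u ∈ x ->
       sat (scons u (scons v e)) phi -> sat (scons u (scons v' e)) phi ->
       v = v') ->
    exists y, isset y /\
      forall v, v ∈ y <-> exists u, u ∈ x /\ sat (scons u (scons v e)) phi;
  zfa_foundation : forall x, (exists y, y ∈ x) ->
    exists y, y ∈ x /\ ~ exists z, z ∈ y /\ z ∈ x
}.

(* The recursion defining the action of pi, carried out inside the structure on
   a transitive set T; f is the restriction of the action to T. *)
Definition is_action_on (pi T f : M) : Prop :=
  transitive T /\ is_function f T /\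
  forall x y, x ∈ T -> rel f x y ->
    (atom x -> rel pi x y) /\
    (isset x -> isset y /\
       forall z, z ∈ y <-> exists u, u ∈ x /\ rel f u z).

(* pi[x] = y.  The definition is internal because the structure may be
   externally ill-founded. *)
Definition act (pi x y : M) : Prop :=
  exists T f, is_action_on pi T f /\ x ∈ T /\ rel f x y.

Record is_perm_group (A Psi : M) : Prop := {
  pg_isset : isset Psi;
  pg_bij : forall s, s ∈ Psi -> is_bijection s A A;
  pg_id : exists i, i ∈ Psi /\ is_id i A;
  pg_comp : forall s t, s ∈ Psi -> t ∈ Psi ->
    exists r, r ∈ Psi /\ is_comp r s t;
  pg_inv : forall s, s ∈ Psi -> exists r, r ∈ Psi /\ is_inverse r s
}.

Definition is_subgroup (A Sigma Psi : M) : Prop :=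
  subset Psi Sigma /\ is_perm_group A Psi.

Definition in_stab (Sigma x s : M) : Prop := s ∈ Sigma /\ act s x x.

Definition is_stab (Sigma x Psi : M) : Prop :=
  isset Psi /\ forall s, s ∈ Psi <-> in_stab Sigma x s.

(* r = s t s^-1 *)
Definition is_conj_perm (r s t : M) : Prop :=
  exists s' u, is_inverse s' s /\ is_comp u s t /\ is_comp r u s'.

Record is_normal_filter (A Sigma F : M) : Prop := {
  nf_isset : isset F;
  nf_subgroup : forall Psi, Psi ∈ F -> is_subgroup A Sigma Psi;
  nf_top : Sigma ∈ F;
  nf_up : forall Psi Phi, Psi ∈ F -> is_subgroup A Sigma Phi ->
    subset Psi Phi -> Phi ∈ F;
  nf_inter : forall Psi Phi, Psi ∈ F -> Phi ∈ F ->
    exists Theta, Theta ∈ F /\ isset Theta /\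
      forall s, s ∈ Theta <-> s ∈ Psi /\ s ∈ Phi;
  nf_conj : forall Psi s, Psi ∈ F -> s ∈ Sigma ->
    exists Theta, Theta ∈ F /\ isset Theta /\
      forall r, r ∈ Theta <->
        r ∈ Sigma /\ exists t, t ∈ Psi /\ is_conj_perm r s t;
  nf_atoms : forall a, a ∈ A -> exists Psi, Psi ∈ F /\ is_stab Sigma a Psi
}.

Definition symmetric (Sigma F x : M) : Prop :=
  exists Psi, Psi ∈ F /\ is_stab Sigma x Psi.

Definition hereditarily_symmetric (Sigma F x : M) : Prop :=
  symmetric Sigma F x /\
  exists T, is_tc T x /\ forall z, z ∈ T -> symmetric Sigma F z.

Definition mul (m x y z : M) : Prop := exists p, p ∈ m /\ is_triple p x y z.

Definition is_unit (X m e : M) : Prop :=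
  e ∈ X /\ forall x, x ∈ X -> mul m e x x /\ mul m x e x.

(* Gamma is the group (X, m), with m the graph of a map X * X -> X. *)
Record is_group (Gamma X m : M) : Prop := {
  grp_pair : is_opair Gamma X m;
  grp_carrier : isset X;
  grp_isset : isset m;
  grp_graph : forall p, p ∈ m ->
    exists x y z, x ∈ X /\ y ∈ X /\ z ∈ X /\ is_triple p x y z;
  grp_total : forall x y, x ∈ X -> y ∈ X -> exists! z, mul m x y z;
  grp_assoc : forall x y z xy yz w, x ∈ X -> y ∈ X -> z ∈ X ->
    mul m x y xy -> mul m y z yz -> (mul m xy z w <-> mul m x yz w);
  grp_unit_inv : exists e, is_unit X m e /\
    forall x, x ∈ X -> exists y, y ∈ X /\ mul m x y e /\ mul m y x e
}.

(* d = g c g^-1 *)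
Definition is_conjugate (X m g c d : M) : Prop :=
  exists e g' u, is_unit X m e /\ g' ∈ X /\ mul m g g' e /\ mul m g' g e /\
    mul m g c u /\ mul m u g' d.

(* R is the graph of a map on X, given as a class. *)
Definition is_inner (X m : M) (R : M -> M -> Prop) : Prop :=
  exists g, g ∈ X /\
    forall c, c ∈ X -> forall d, R c d <-> is_conjugate X m g c d.

Definition isomorphic_groups (X m Y n : M) : Prop :=
  exists f, is_bijection f X Y /\
    forall x y z x' y' z', x ∈ X -> y ∈ X -> mul m x y z ->
      rel f x x' -> rel f y y' -> rel f z z' -> mul n x' y' z'.

Record is_graph (G V E : M) : Prop := {
  gr_pair : is_opair G V E;
  gr_vertices : isset V;
  gr_isset : isset E;
  gr_edges : forall p, p ∈ E -> exists x y, x ∈ V /\ y ∈ V /\ is_opair p x y;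
  gr_sym : forall x y, rel E x y -> rel E y x;
  gr_irrefl : forall x, ~ rel E x x
}.

Definition is_automorphism (V E f : M) : Prop :=
  is_bijection f V V /\
  forall x y x' y', x ∈ V -> y ∈ V -> rel f x x' -> rel f y y' ->
    (rel E x y <-> rel E x' y').

(* B = (Y, n) is the group of all automorphisms of (V, E) under composition. *)
Definition is_aut_group (V E B Y n : M) : Prop :=
  is_opair B Y n /\
  isset Y /\ (forall f, f ∈ Y <-> is_automorphism V E f) /\
  isset n /\
  (forall p, p ∈ n <-> exists f g h, f ∈ Y /\ g ∈ Y /\ h ∈ Y /\
     is_triple p f g h /\ is_comp h f g).

End Vocabulary.

(* The class of hereditarily symmetric elements, as a substructure; notions
   read in this structure are relativized to the permutation model. *)
Definition perm_model (M : set_structure) (Sigma F : M) : set_structure :=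
  @SetStructure { x : M | hereditarily_symmetric Sigma F x }
    (fun x y => proj1_sig x ∈ proj1_sig y)
    (fun x => atom (proj1_sig x)).

Definition incl (M : set_structure) (Sigma F : M)
  (x : perm_model Sigma F) : M := proj1_sig x.

(* Main.v *)
Require Import Defs.
From Stdlib Require Import Classical.

(** Suppose that [phi] is an isomorphism in [M'] from [Gamma] to [Aut(G)], where
    [G = (V, E)].  The permutations that fix [Gamma], its carrier, [V], [E] and
    [phi] include a member of the filter, so some such [pi] in [M'] acts on [Gamma]
    by an automorphism that is not inner.  As [pi] fixes [V] and [E], its action on
    [V] is an automorphism [rho] of [G].  It belongs to [M'] because a permutation
    that fixes [pi] and [V] also fixes [rho] ([HS_restricted_action]).  Hence
    [rho = phi g] for some [g] in [Gamma].  Every automorphism [f] of [G] satisfies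
    [pi[f] = rho f rho^-1], and [pi] fixes [phi], so [pi] acts on [Gamma] as
    conjugation by [g] ([act_inner]): a contradiction.

    The action is defined by attempts, that is, functions on transitive sets that
    obey its recursion.  Inductions on membership below a transitive set show that
    it is functional and injective ([act_eq_iff]), total on members of transitive
    sets ([act_total]), and compatible with composition ([act_comp]).
    Consequently stabilizers are subgroups, and to be symmetric it is enough to be
    fixed by a member of the filter ([symmetric_intro]). *)

Set Implicit Arguments.
Unset Strict Implicit.

(** * Definable classes *)

(** Separation and replacement are stated for formulas, so each class used with
    them has to be shown definable.  A condition on environments, rather than on
    one or two variables, is what can be closed under quantifiers; parameters are
    entries of the environment. *)
Definition definable (M : set_structure) (P : (nat -> M) -> Prop) : Prop :=
  exists phi : formula, forall e, sat e phi <-> P e.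

Section Definability.
Variable M : set_structure.
Implicit Types P Q : (nat -> M) -> Prop.

Lemma definable_mem (i j : nat) : definable (fun e : nat -> M => e i ∈ e j).
Proof. exists (fMem i j); simpl; tauto. Qed.

Lemma definable_eq (i j : nat) : definable (fun e : nat -> M => e i = e j).
Proof. exists (fEq i j); simpl; tauto. Qed.

Lemma definable_atom (i : nat) : definable (fun e : nat -> M => atom (e i)).
Proof. exists (fAtom i); simpl; tauto. Qed.

Lemma definable_False : definable (fun _ : nat -> M => False).
Proof. exists fFalse; simpl; tauto. Qed.

Lemma definable_imp P Q :
  definable P -> definable Q -> definable (fun e => P e -> Q e).
Proof.
  intros [p Hp] [q Hq]; exists (fImp p q); intro e; simpl.
  rewrite Hp, Hq; tauto.
Qed.

Lemma definable_and P Q :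
  definable P -> definable Q -> definable (fun e => P e /\ Q e).
Proof.
  intros [p Hp] [q Hq]; exists (fAnd p q); intro e; simpl.
  rewrite Hp, Hq; tauto.
Qed.

Lemma definable_or P Q :
  definable P -> definable Q -> definable (fun e => P e \/ Q e).
Proof.
  intros [p Hp] [q Hq]; exists (fOr p q); intro e; simpl.
  rewrite Hp, Hq; tauto.
Qed.

(** For [e' = scons x e] the terms [fun n => e' (S n)] and [e' 0] are convertible
    to [e] and [x].  Hence the bound variable needs no renaming, and the lemma
    applies to any quantified body by higher-order unification. *)
Lemma definable_all (P : (nat -> M) -> M -> Prop) :
  definable (fun e => P (fun n => e (S n)) (e 0)) ->
  definable (fun e => forall x, P e x).
Proof.
  intros [p Hp]; exists (fAll p); intro e; simpl.
  split; intros H x; specialize (H x); [ apply Hp in H | apply Hp ]; exact H.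
Qed.

Lemma definable_ex (P : (nat -> M) -> M -> Prop) :
  definable (fun e => P (fun n => e (S n)) (e 0)) ->
  definable (fun e => exists x, P e x).
Proof.
  intros [p Hp]; exists (fEx p); intro e; simpl.
  split; intros [x H]; exists x; [ apply Hp in H | apply Hp ]; exact H.
Qed.

End Definability.

(** Proves the definability of an explicit condition on an environment.  The
    defined notions are unfolded down to membership, equality and atomhood, and
    each variable [x] bound by the condition becomes an entry of the environment. *)
Ltac definability :=
  unfold act, is_action_on, is_function, is_tc, rel, is_opair, is_upair,
    transitive, subset, isset, unique, iff, not;
  repeat (cbv beta; first
    [ apply definable_mem | apply definable_eq | apply definable_atom
    | apply definable_False | apply definable_and | apply definable_or
    | apply definable_all | apply definable_ex | apply definable_imp ]).

Definition env1 (M : set_structure) (a : M) : nat -> M := fun _ => a.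
Definition env2 (M : set_structure) (a b : M) : nat -> M := scons a (env1 b).

(** * Set theory in a model of ZFA *)

Section SetTheory.
Variable M : set_structure.
Hypothesis HM : is_ZFA M.
Implicit Types x y z T : M.

Lemma separation (P : M -> (nat -> M) -> Prop) (e : nat -> M) x :
  definable (fun e => P (e 0) (fun n => e (S n))) ->
  exists y, isset y /\ forall z, z ∈ y <-> z ∈ x /\ P z e.
Proof.
  intros [phi Hphi].
  destruct (zfa_separation HM phi e x) as [y [Sy Hy]].
  exists y; split; [ exact Sy | ]; intro z.
  rewrite (Hy z), (Hphi (scons z e)); reflexivity.
Qed.

Lemma replacement (R : M -> M -> (nat -> M) -> Prop) (e : nat -> M) x :
  definable (fun e => R (e 0) (e 1) (fun n => e (S (S n)))) ->
  (forall u v v', u ∈ x -> R u v e -> R u v' e -> v = v') ->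
  exists y, isset y /\ forall v, v ∈ y <-> exists u, u ∈ x /\ R u v e.
Proof.
  intros [phi Hphi] Hfun.
  destruct (zfa_replacement HM (phi := phi) (e := e) (x := x)) as [y [Sy Hy]].
  - intros u v v' Hu Hv Hv'; apply Hphi in Hv; apply Hphi in Hv'.
    exact (Hfun u v v' Hu Hv Hv').
  - exists y; split; [ exact Sy | ]; intro v; rewrite (Hy v).
    split; intros [u [Hu Hv]]; exists u; split; trivial;
      [ apply Hphi in Hv | apply Hphi ]; exact Hv.
Qed.

(** Foundation concerns sets only, so induction on membership is available below
    a transitive set: otherwise the counterexamples in [T] form a set with a
    minimal element. *)
Lemma transitive_induction (P : M -> (nat -> M) -> Prop) (e : nat -> M) T :
  definable (fun e => P (e 0) (fun n => e (S n))) ->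
  transitive T ->
  (forall x, x ∈ T -> (forall u, u ∈ x -> P u e) -> P x e) ->
  forall x, x ∈ T -> P x e.
Proof.
  intros HP HT IH x Hx; apply NNPP; intro Hn.
  destruct (separation (P := fun x e => ~ P x e) e T) as [B [_ HB]].
  { apply definable_imp; [ exact HP | apply definable_False ]. }
  destruct (zfa_foundation HM (x := B)) as [y [Hy Hmin]].
  { exists x; apply HB; auto. }
  apply HB in Hy as [HyT HyP]; apply HyP, (IH y HyT).
  intros u Hu; apply NNPP; intro Hnu; apply Hmin; exists u; split; trivial.
  apply HB; split; [ exact (HT y HyT u Hu) | exact Hnu ].
Qed.

Lemma mem_isset x z : z ∈ x -> isset x.
Proof. intros Hz Hx; exact (zfa_atom_no_elements HM Hx Hz). Qed.

Lemma upair_unique p q x y : is_upair p x y -> is_upair q x y -> p = q.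
Proof.
  intros [Sp Hp] [Sq Hq]; apply (zfa_extensionality HM Sp Sq).
  intro z; rewrite (Hp z), (Hq z); tauto.
Qed.

Lemma opair_unique p q x y : is_opair p x y -> is_opair q x y -> p = q.
Proof.
  intros [a [b [Ha [Hb Hp]]]] [a' [b' [Ha' [Hb' Hq]]]].
  rewrite (upair_unique Ha' Ha), (upair_unique Hb' Hb) in Hq.
  exact (upair_unique Hp Hq).
Qed.

Lemma opair_exists x y : exists p, is_opair p x y.
Proof.
  destruct (zfa_pairing HM x x) as [a Ha], (zfa_pairing HM x y) as [b Hb].
  destruct (zfa_pairing HM a b) as [p Hp].
  exists p, a, b; auto.
Qed.

Lemma upair_inj p x y x' y' : is_upair p x y -> is_upair p x' y' ->
  (x = x' /\ y = y') \/ (x = y' /\ y = x').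
Proof.
  intros [_ H] [_ H'].
  assert (K : forall z, z = x \/ z = y <-> z = x' \/ z = y').
  { intro z; rewrite <- (H z); exact (H' z). }
  destruct (proj1 (K x) (or_introl eq_refl)) as [E|E],
    (proj1 (K y) (or_intror eq_refl)) as [E1|E1],
    (proj2 (K x') (or_introl eq_refl)) as [E2|E2],
    (proj2 (K y') (or_intror eq_refl)) as [E3|E3];
    subst; auto.
Qed.

Lemma opair_inj p x y x' y' :
  is_opair p x y -> is_opair p x' y' -> x = x' /\ y = y'.
Proof.
  intros [a [b [Ha [Hb Hp]]]] [a' [b' [Ha' [Hb' Hp']]]].
  destruct (upair_inj Hp Hp') as [[E E']|[E E']]; subst a' b';
    [ destruct (upair_inj Ha Ha') as [[E _]|[E _]]; subst x';
      destruct (upair_inj Hb Hb') as [[_ E]|[E E']]; subst; auto | ].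
  destruct (upair_inj Ha Hb') as [[E E']|[E E']];
    destruct (upair_inj Hb Ha') as [[E1 E1']|[E1 E1']]; subst; auto.
Qed.

Lemma triple_inj p x y z x' y' z' :
  is_triple p x y z -> is_triple p x' y' z' -> x = x' /\ y = y' /\ z = z'.
Proof.
  intros [q [Hq Hp]] [q' [Hq' Hp']].
  destruct (opair_inj Hp Hp') as [E Ez]; subst q'.
  destruct (opair_inj Hq Hq') as [Ex Ey]; auto.
Qed.

Lemma mem_rel r p x y : is_opair p x y -> (p ∈ r <-> rel r x y).
Proof.
  intro Hp; split.
  - intro H; exists p; auto.
  - intros [q [Hq Hq']]; rewrite (opair_unique Hp Hq'); exact Hq.
Qed.

Lemma function_dom f X x y : is_function f X -> rel f x y -> x ∈ X.
Proof.
  intros [_ [H _]] [p [Hp Hxy]]; destruct (H p Hp) as [x0 [y0 [Hx0 H0]]].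
  destruct (opair_inj Hxy H0) as [E _]; subst x0; exact Hx0.
Qed.

Lemma function_total f X x : is_function f X -> x ∈ X -> exists y, rel f x y.
Proof.
  intros [_ [_ H]] Hx; destruct (H x Hx) as [y [Hy _]]; exists y; exact Hy.
Qed.

Lemma function_unique f X x y y' :
  is_function f X -> rel f x y -> rel f x y' -> y = y'.
Proof.
  intros Hf H H'; destruct (proj2 (proj2 Hf) x (function_dom Hf H)) as [w [_ Hw]].
  rewrite <- (Hw y H); exact (Hw y' H').
Qed.

Lemma function_ext f g D D' : is_function f D -> is_function g D' ->
  (forall x y, rel f x y <-> rel g x y) -> f = g.
Proof.
  intros Hf Hg H; apply (zfa_extensionality HM (proj1 Hf) (proj1 Hg)).
  intro p; split; intro Hp.
  - destruct (proj1 (proj2 Hf) p Hp) as [x [y [_ Hxy]]].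
    apply (mem_rel g Hxy), H; exists p; auto.
  - destruct (proj1 (proj2 Hg) p Hp) as [x [y [_ Hxy]]].
    apply (mem_rel f Hxy), H; exists p; auto.
Qed.

Lemma bijection_inj s X Y x x' y :
  is_bijection s X Y -> rel s x y -> rel s x' y -> x = x'.
Proof.
  intros [Hs [Hs' Hi]] H H'; destruct (Hi y (Hs' x y H)) as [w [_ Hw]].
  rewrite <- (Hw x H); exact (Hw x' H').
Qed.

Lemma union2_exists x y :
  exists z, isset z /\ forall t, t ∈ z <-> t ∈ x \/ t ∈ y.
Proof.
  destruct (zfa_pairing HM x y) as [p [_ Hp]].
  destruct (zfa_union HM p) as [z [Sz Hz]].
  exists z; split; trivial; intro t; rewrite (Hz t); split.
  - intros [u [Hu Ht]]; apply Hp in Hu as [E|E]; subst; auto.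
  - intros [H|H]; [ exists x | exists y ]; split; trivial; apply Hp; auto.
Qed.

(** Membership in a transitive set takes the place of the existence of transitive
    closures for arbitrary elements, which would need a recursion over the
    natural numbers.  It holds wherever an action is defined, and for sets of
    hereditarily symmetric elements. *)
Definition bounded x : Prop := exists T, transitive T /\ x ∈ T.

(** The witness is [T] with [x] added as an element. *)
Lemma bounded_subset x T : transitive T -> subset x T -> bounded x.
Proof.
  intros HT Hx.
  destruct (zfa_pairing HM x x) as [p [_ Hp]].
  destruct (union2_exists T p) as [U [_ HU]].
  exists U; split.
  - intros y Hy z Hz; apply HU; left; apply HU in Hy as [Hy|Hy].
    + exact (HT y Hy z Hz).
    + apply Hp in Hy; assert (y = x) by tauto; subst y; exact (Hx z Hz).
  - apply HU; right; apply Hp; auto.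
Qed.

Lemma bounded_upair p x y :
  is_upair p x y -> bounded x -> bounded y -> bounded p.
Proof.
  intros [_ Hp] [T [HT Hx]] [U [HU Hy]].
  destruct (union2_exists T U) as [W [_ HW]].
  apply bounded_subset with W.
  - intros a Ha b Hb; apply HW; apply HW in Ha as [Ha|Ha];
      [ left; exact (HT a Ha b Hb) | right; exact (HU a Ha b Hb) ].
  - intros z Hz; apply HW; apply Hp in Hz as [E|E]; subst; auto.
Qed.

(** The closure is cut out of [T] as the intersection of all transitive sets
    that include [x]. *)
Lemma tc_exists x T : transitive T -> subset x T ->
  exists U, is_tc U x /\ subset U T.
Proof.
  intros HT Hx.
  destruct (separation
    (P := fun z e => forall U, isset U -> transitive U -> subset (e 0) U -> z ∈ U)
    (env1 x) T) as [U [SU HU]].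
  { definability. }
  simpl in HU; unfold env1 in HU.
  exists U; split; [ repeat split | ]; trivial.
  - intros y Hy z Hz; apply HU in Hy as [HyT Hy]; apply HU; split.
    + exact (HT y HyT z Hz).
    + intros W SW HW HxW; exact (HW y (Hy W SW HW HxW) z Hz).
  - intros z Hz; apply HU; split; auto.
  - intros W SW HW HxW z Hz; apply HU in Hz as [_ Hz]; exact (Hz W SW HW HxW).
  - intros z Hz; apply HU in Hz; tauto.
Qed.

Lemma tc_unique T U x : is_tc T x -> is_tc U x -> T = U.
Proof.
  intros [ST [HT [HxT MT]]] [SU [HU [HxU MU]]].
  apply (zfa_extensionality HM ST SU); intro z; split.
  - exact (MT U SU HU HxU z).
  - exact (MU T ST HT HxT z).
Qed.

Lemma mem_bounded x z : bounded x -> z ∈ x -> bounded z.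
Proof. intros [T [HT Hx]] Hz; exists T; split; [ exact HT | exact (HT x Hx z Hz) ]. Qed.

Lemma rel_bounded R x y : bounded R -> rel R x y -> bounded x /\ bounded y.
Proof.
  intros [T [HT HR]] [p [Hp [a [b [_ [Hb Hab]]]]]].
  pose proof (HT R HR p Hp) as Tp.
  assert (Tb : b ∈ T) by (apply (HT p Tp); apply Hab; auto).
  split; exists T; split; trivial; apply (HT b Tb); apply Hb; auto.
Qed.

Lemma act_bounded s x y : act s x y -> bounded x.
Proof. intros [T [f [[HT _] [Hx _]]]]; exists T; auto. Qed.

Lemma act_atom s x y : act s x y -> atom x -> rel s x y.
Proof.
  intros [T [f [[_ [_ H]] [Hx Hxy]]]]; exact (proj1 (H x y Hx Hxy)).
Qed.

Lemma act_isset s x y : act s x y -> isset x -> isset y.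
Proof.
  intros [T [f [[_ [_ H]] [Hx Hxy]]]] Sx; exact (proj1 (proj2 (H x y Hx Hxy) Sx)).
Qed.

(** * The action of a permutation on the universe *)

(** Attempts for different arguments are different functions, and it is not yet
    known that they agree.  This lemma and the next use a single attempt: the one
    that witnesses [act s x y] also witnesses the action on the elements. *)
Lemma act_mem_image s x y u : act s x y -> u ∈ x -> exists w, w ∈ y /\ act s u w.
Proof.
  intros [T [f [Hact [Hx Hxy]]]] Hu.
  pose proof Hact as [HT [Hf H]].
  destruct (function_total Hf (HT x Hx u Hu)) as [w Hw].
  exists w; split.
  - apply (proj2 (H x y Hx Hxy) (mem_isset Hu)); exists u; auto.
  - exists T, f; split; [ exact Hact | split; [ exact (HT x Hx u Hu) | exact Hw ] ].
Qed.

Lemma act_mem_preimage s x y w :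
  act s x y -> isset x -> w ∈ y -> exists u, u ∈ x /\ act s u w.
Proof.
  intros [T [f [Hact [Hx Hxy]]]] Sx Hw.
  pose proof Hact as [HT [Hf H]].
  apply (proj2 (H x y Hx Hxy) Sx) in Hw as [u [Hu Huw]].
  exists u; split; trivial.
  exists T, f; split; [ exact Hact | split; [ exact (HT x Hx u Hu) | exact Huw ] ].
Qed.

Section Action.
Variable A : M.
Hypothesis HA : is_atom_set A.

Lemma bijection_atoms s x y :
  is_bijection s A A -> rel s x y -> atom x /\ atom y.
Proof.
  intros [Hs [Hs' _]] H; split; apply (proj2 HA).
  - exact (function_dom Hs H).
  - exact (Hs' x y H).
Qed.

Lemma act_atom_iff s x y : is_bijection s A A -> act s x y -> (atom x <-> atom y).
Proof.
  intros Hs H; split.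
  - intro Hx; exact (proj2 (bijection_atoms Hs (act_atom H Hx))).
  - intro Hy; apply NNPP; intro Hx; exact (act_isset H Hx Hy).
Qed.

(** The action is a function and is injective.  Both are proved by one induction:
    if they hold for the elements of [x], then [x] and [x'] have the same elements
    exactly when their images do. *)
Lemma act_eq_iff s x y x' y' :
  is_bijection s A A -> act s x y -> act s x' y' -> (x = x' <-> y = y').
Proof.
  intros Hs H H'; destruct (act_bounded H) as [T [HT Hx]].
  revert x' y y' H H'.
  apply (transitive_induction (P := fun x e => forall x' y y',
    act (e 0) x y -> act (e 0) x' y' -> (x = x' <-> y = y')) (e := env1 s) (T := T));
    [ definability | exact HT | | exact Hx ].
  clear x Hx; unfold env1; intros x Hx IH x' y y' H H'.
  destruct (classic (atom x)) as [Ax|Sx].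
  - pose proof (act_atom H Ax) as R; split; intro E.
    + subst x'; exact (function_unique (proj1 Hs) R (act_atom H' Ax)).
    + subst y'; pose proof (proj1 (act_atom_iff Hs H) Ax) as Ay.
      exact (bijection_inj Hs R (act_atom H' (proj2 (act_atom_iff Hs H') Ay))).
  - pose proof (act_isset H Sx) as Sy.
    split; intro E.
    + subst x'; apply (zfa_extensionality HM Sy (act_isset H' Sx)).
      intro z; split; intro Hz.
      * destruct (act_mem_preimage H Sx Hz) as [u [Hu Huz]].
        destruct (act_mem_image H' Hu) as [w [Hw Huw]].
        rewrite (proj1 (IH u Hu u z w Huz Huw) eq_refl); exact Hw.
      * destruct (act_mem_preimage H' Sx Hz) as [u [Hu Huz]].
        destruct (act_mem_image H Hu) as [w [Hw Huw]].
        rewrite (proj1 (IH u Hu u z w Huz Huw) eq_refl); exact Hw.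
    + subst y'; assert (Sx' : isset x').
      { intro Ax'; exact (Sy (proj1 (act_atom_iff Hs H') Ax')). }
      apply (zfa_extensionality HM Sx Sx'); intro z; split; intro Hz.
      * destruct (act_mem_image H Hz) as [w [Hw Hzw]].
        destruct (act_mem_preimage H' Sx' Hw) as [u [Hu Huw]].
        rewrite (proj2 (IH z Hz u w w Hzw Huw) eq_refl); exact Hu.
      * destruct (act_mem_image H' Hz) as [w [Hw Hzw]].
        destruct (act_mem_preimage H Sx Hw) as [u [Hu Huw]].
        rewrite <- (proj2 (IH u Hu z w w Huw Hzw) eq_refl); exact Hu.
Qed.

Lemma act_unique s x y y' :
  is_bijection s A A -> act s x y -> act s x y' -> y = y'.
Proof. intros Hs H H'; exact (proj1 (act_eq_iff Hs H H') eq_refl). Qed.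

Lemma act_mem_iff s x y u w : is_bijection s A A ->
  act s x y -> act s u w -> (u ∈ x <-> w ∈ y).
Proof.
  intros Hs H K; split; intro Hm.
  - destruct (act_mem_image H Hm) as [w' [Hw' K']].
    rewrite (act_unique Hs K K'); exact Hw'.
  - assert (Sx : isset x).
    { intro Ax; exact (mem_isset Hm (proj1 (act_atom_iff Hs H) Ax)). }
    destruct (act_mem_preimage H Sx Hm) as [u' [Hu' K']].
    rewrite (proj2 (act_eq_iff Hs K K') eq_refl); exact Hu'.
Qed.

(** The recursion equation of the action at [x], with the action itself as the
    function on the elements.  It determines [y] even where [act] is not known to
    be defined at [x]. *)
Definition act_step s x y : Prop :=
  (atom x -> rel s x y) /\
  (isset x -> isset y /\ forall z, z ∈ y <-> exists u, u ∈ x /\ act s u z).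

Lemma act_satisfies_step s x y : is_bijection s A A -> act s x y -> act_step s x y.
Proof.
  intros Hs H; split; [ exact (act_atom H) | ].
  intro Sx; split; [ exact (act_isset H Sx) | ].
  intro z; split; [ exact (act_mem_preimage H Sx) | ].
  intros [u [Hu Huz]]; exact (proj1 (act_mem_iff Hs H Huz) Hu).
Qed.

Lemma act_step_unique s x y y' :
  is_bijection s A A -> act_step s x y -> act_step s x y' -> y = y'.
Proof.
  intros Hs [Ha Hi] [Ha' Hi']; destruct (classic (atom x)) as [Ax|Sx].
  - exact (function_unique (proj1 Hs) (Ha Ax) (Ha' Ax)).
  - destruct (Hi Sx) as [Sy Hy], (Hi' Sx) as [Sy' Hy'].
    apply (zfa_extensionality HM Sy Sy'); intro z.
    rewrite (Hy z), (Hy' z); tauto.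
Qed.

Lemma act_step_exists s x : is_bijection s A A ->
  (forall u, u ∈ x -> exists w, act s u w) -> exists y, act_step s x y.
Proof.
  intros Hs Hd; destruct (classic (atom x)) as [Ax|Sx].
  - destruct (function_total (proj1 Hs) (proj2 (proj2 HA x) Ax)) as [y Hy].
    exists y; split; [ auto | intro Sx; destruct (Sx Ax) ].
  - destruct (replacement (R := fun u v e => act (e 0) u v) (e := env1 s) (x := x))
      as [y [Sy Hy]].
    { definability. }
    { intros u v v' _; exact (@act_unique s u v v' Hs). }
    exists y; split; [ intro Ax; destruct (Sx Ax) | auto ].
Qed.

(** The graph of [act_step] on [T] is an attempt, because on the elements of
    members of [T] the relations [act] and [act_step] coincide. *)
Lemma act_total_of_elements s T : is_bijection s A A -> transitive T ->
  (forall x u, x ∈ T -> u ∈ x -> exists w, act s u w) ->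
  forall x, x ∈ T -> exists y, act s x y.
Proof.
  intros Hs HT Hd.
  destruct (replacement
    (R := fun x p e => exists y, is_opair p x y /\ act_step (e 0) x y)
    (e := env1 s) (x := T)) as [f [Sf Hf]].
  { unfold act_step; definability. }
  { intros x p p' _ [y [Hp Hy]] [y' [Hp' Hy']].
    rewrite (act_step_unique Hs Hy Hy') in Hp; exact (opair_unique Hp Hp'). }
  unfold env1 in Hf.
  assert (Hrel : forall x y, rel f x y <-> x ∈ T /\ act_step s x y).
  { intros x y; split.
    - intros [p [Hp Hxy]]; apply Hf in Hp as [x0 [Hx0 [y0 [Hp0 H0]]]].
      destruct (opair_inj Hxy Hp0); subst; auto.
    - intros [Hx H]; destruct (opair_exists x y) as [p Hp].
      exists p; split; trivial; apply Hf; exists x; split; trivial.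
      exists y; auto. }
  assert (Hfun : is_function f T).
  { split; [ exact Sf | split ].
    - intros p Hp; apply Hf in Hp as [x [Hx [y [Hp _]]]]; exists x, y; auto.
    - intros x Hx.
      destruct (act_step_exists Hs (fun u => Hd x u Hx)) as [y Hy].
      exists y; split; [ apply Hrel; auto | ].
      intros y' Hy'; apply Hrel in Hy' as [_ Hy'].
      exact (act_step_unique Hs Hy Hy'). }
  intros x Hx; destruct (function_total Hfun Hx) as [y Hy].
  exists y, T, f; split; [ | auto ]; split; [ exact HT | split; [ exact Hfun | ] ].
  clear x Hx y Hy; intros x y Hx Hxy; apply Hrel in Hxy as [_ [Ha Hi]].
  split; [ exact Ha | ]; intro Sx; destruct (Hi Sx) as [Sy Hy].
  split; [ exact Sy | ]; intro z; rewrite (Hy z).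
  split; intros [u [Hu Huz]]; exists u; split; trivial.
  - apply Hrel; split; [ exact (HT x Hx u Hu) | exact (act_satisfies_step Hs Huz) ].
  - apply Hrel in Huz as [_ Huz]; destruct (Hd x u Hx Hu) as [w Hw].
    rewrite (act_step_unique Hs Huz (act_satisfies_step Hs Hw)); exact Hw.
Qed.

(** Suppose that the action is defined on all elements of [x].  The members of [T]
    with this property form a transitive set [D], on which the preceding lemma
    makes the action total; and [x] belongs to [D]. *)
Lemma act_total s x : is_bijection s A A -> bounded x -> exists y, act s x y.
Proof.
  intros Hs [T [HT Hx]]; revert x Hx.
  apply (transitive_induction (P := fun x e => exists y, act (e 0) x y)
    (e := env1 s) (T := T)); [ definability | exact HT | ].
  unfold env1; intros x Hx Hd.
  destruct (separation
    (P := fun x e => forall u, u ∈ x -> exists w, act (e 0) u w) (env1 s) T)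
    as [D [_ HD]].
  { definability. }
  unfold env1 in HD.
  apply (@act_total_of_elements s D Hs).
  - intros y Hy z Hz; apply HD in Hy as [HyT Hy]; apply HD; split.
    + exact (HT y HyT z Hz).
    + intros u Hu; destruct (Hy z Hz) as [w Hw].
      destruct (act_mem_image Hw Hu) as [v [_ Hv]]; exists v; exact Hv.
  - intros y u Hy; apply HD in Hy as [_ Hy]; exact (Hy u).
  - apply HD; auto.
Qed.

Lemma act_of_elements s x y : is_bijection s A A -> bounded x ->
  isset x -> isset y ->
  (forall u, u ∈ x -> exists w, w ∈ y /\ act s u w) ->
  (forall w, w ∈ y -> exists u, u ∈ x /\ act s u w) -> act s x y.
Proof.
  intros Hs Hx Sx Sy H1 H2; destruct (act_total Hs Hx) as [q Hq].
  replace y with q; [ exact Hq | ].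
  apply (zfa_extensionality HM (act_isset Hq Sx) Sy); intro z; split; intro Hz.
  - destruct (act_mem_preimage Hq Sx Hz) as [u [Hu Huz]].
    destruct (H1 u Hu) as [w [Hw Huw]].
    rewrite (act_unique Hs Huz Huw); exact Hw.
  - destruct (H2 z Hz) as [u [Hu Huz]].
    exact (proj1 (act_mem_iff Hs Hq Huz) Hu).
Qed.

Lemma act_of_atom s x y : is_bijection s A A -> rel s x y -> act s x y.
Proof.
  intros Hs H; destruct (bijection_atoms Hs H) as [Ax _].
  assert (Hb : bounded x).
  { apply bounded_subset with x; [ | intros z; auto ].
    intros u Hu; destruct (mem_isset Hu Ax). }
  destruct (act_total Hs Hb) as [q Hq].
  rewrite (function_unique (proj1 Hs) H (act_atom Hq Ax)); exact Hq.
Qed.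

(** Since the action is total below transitive sets, an induction on elements
    suffices, and no attempts have to be composed. *)
Lemma act_comp r s t x y z : is_bijection r A A -> is_bijection s A A ->
  is_bijection t A A -> is_comp r s t -> act t x y -> act s y z -> act r x z.
Proof.
  intros Hr Hs Ht Hc Hxy Hyz; destruct (act_bounded Hxy) as [T [HT Hx]].
  revert y z Hxy Hyz.
  apply (transitive_induction (P := fun x e => forall y z,
    act (e 0) x y -> act (e 1) y z -> act (e 2) x z)
    (e := scons t (env2 s r)) (T := T));
    [ definability | exact HT | | exact Hx ].
  clear x Hx; simpl; unfold env1; intros x Hx IH y z Hxy Hyz.
  destruct (classic (atom x)) as [Ax|Sx].
  - apply (act_of_atom Hr), Hc; exists y; split; [ exact (act_atom Hxy Ax) | ].
    exact (act_atom Hyz (proj1 (act_atom_iff Ht Hxy) Ax)).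
  - pose proof (act_isset Hxy Sx) as Sy.
    apply act_of_elements; trivial.
    + exists T; auto.
    + exact (act_isset Hyz Sy).
    + intros u Hu; destruct (act_mem_image Hxy Hu) as [v [Hv Huv]].
      destruct (act_mem_image Hyz Hv) as [w [Hw Hvw]].
      exists w; split; trivial; exact (IH u Hu v w Huv Hvw).
    + intros w Hw; destruct (act_mem_preimage Hyz Sy Hw) as [v [Hv Hvw]].
      destruct (act_mem_preimage Hxy Sx Hv) as [u [Hu Huv]].
      exists u; split; trivial; exact (IH u Hu v w Huv Hvw).
Qed.

Lemma act_id i x : is_bijection i A A -> is_id i A -> bounded x -> act i x x.
Proof.
  intros Hi Hid [T [HT Hx]]; revert x Hx.
  apply (transitive_induction (P := fun x e => act (e 0) x x)
    (e := env1 i) (T := T)); [ definability | exact HT | ].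
  unfold env1; intros x Hx IH; destruct (classic (atom x)) as [Ax|Sx].
  - apply (act_of_atom Hi), Hid; split; trivial; apply (proj2 HA); exact Ax.
  - apply act_of_elements; trivial; [ exists T; auto | | ];
      intros u Hu; exists u; auto.
Qed.

Lemma act_upair s p p' x x' y y' : is_bijection s A A ->
  is_upair p x y -> is_upair p' x' y' ->
  act s x x' -> act s y y' -> act s p p'.
Proof.
  intros Hs Hp Hp' Hx Hy; apply act_of_elements; trivial.
  - exact (bounded_upair Hp (act_bounded Hx) (act_bounded Hy)).
  - exact (proj1 Hp).
  - exact (proj1 Hp').
  - intros u Hu; apply Hp in Hu as [E|E]; subst;
      [ exists x' | exists y' ]; split; trivial; apply Hp'; auto.
  - intros u Hu; apply Hp' in Hu as [E|E]; subst;
      [ exists x | exists y ]; split; trivial; apply Hp; auto.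
Qed.

Lemma act_opair s p p' x x' y y' : is_bijection s A A ->
  is_opair p x y -> is_opair p' x' y' ->
  act s x x' -> act s y y' -> act s p p'.
Proof.
  intros Hs [a [b [Ha [Hb Hp]]]] [a' [b' [Ha' [Hb' Hp']]]] Hx Hy.
  exact (act_upair Hs Hp Hp' (act_upair Hs Ha Ha' Hx Hx)
    (act_upair Hs Hb Hb' Hx Hy)).
Qed.

Lemma act_rel_iff s R R' x x' y y' : is_bijection s A A ->
  act s R R' -> act s x x' -> act s y y' -> (rel R x y <-> rel R' x' y').
Proof.
  intros Hs HR Hx Hy.
  destruct (opair_exists x y) as [p Hp], (opair_exists x' y') as [p' Hp'].
  rewrite <- (mem_rel R Hp), <- (mem_rel R' Hp').
  exact (act_mem_iff Hs HR (act_opair Hs Hp Hp' Hx Hy)).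
Qed.

End Action.
End SetTheory.

(** * Conjugation by the action of a permutation *)

Section Groups.
Variable M : set_structure.
Hypothesis HM : is_ZFA M.
Variables Gamma X m : M.
Hypothesis HG : is_group Gamma X m.

Lemma mul_mem x y z : mul m x y z -> x ∈ X /\ y ∈ X /\ z ∈ X.
Proof.
  intros [p [Hp Ht]]; destruct (grp_graph HG Hp) as [x0 [y0 [z0 [Hx [Hy [Hz Ht0]]]]]].
  destruct (triple_inj Ht Ht0) as [Ex [Ey Ez]]; subst; auto.
Qed.

Lemma mul_unique x y z z' : mul m x y z -> mul m x y z' -> z = z'.
Proof.
  intros H H'; destruct (mul_mem H) as [Hx [Hy _]].
  destruct (grp_total HG Hx Hy) as [w [_ Hw]].
  rewrite <- (Hw z H); exact (Hw z' H').
Qed.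

Lemma mul_total x y : x ∈ X -> y ∈ X -> exists z, z ∈ X /\ mul m x y z.
Proof.
  intros Hx Hy; destruct (grp_total HG Hx Hy) as [z [Hz _]].
  exists z; split; [ apply (mul_mem Hz) | exact Hz ].
Qed.

Lemma inverse_exists g : g ∈ X -> exists e g',
  is_unit X m e /\ g' ∈ X /\ mul m g g' e /\ mul m g' g e.
Proof.
  intro Hg; destruct (grp_unit_inv HG) as [e [He Hinv]].
  destruct (Hinv g Hg) as [g' Hg']; exists e, g'; auto.
Qed.

Lemma mul_inverse_r d g u e g' : is_unit X m e -> mul m g g' e ->
  mul m d g u -> mul m u g' d.
Proof.
  intros [_ He] Hgg' Hu; destruct (mul_mem Hu) as [Hd [Hg _]].
  destruct (mul_mem Hgg') as [_ [Hg' _]].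
  apply (grp_assoc HG d Hd Hg Hg' Hu Hgg'), (He d Hd).
Qed.

Lemma mul_cancel_r d d' g u : mul m d g u -> mul m d' g u -> d = d'.
Proof.
  intros H H'; destruct (mul_mem H) as [_ [Hg _]].
  destruct (inverse_exists Hg) as [e [g' [He [_ [Hgg' _]]]]].
  exact (mul_unique (mul_inverse_r He Hgg' H) (mul_inverse_r He Hgg' H')).
Qed.

(** The right-hand side has no inverses: this is the form in which a homomorphism
    to a group of bijections is easiest to exploit. *)
Lemma conjugate_iff g c d u :
  mul m g c u -> (is_conjugate X m g c d <-> mul m d g u).
Proof.
  intro Hu; destruct (mul_mem Hu) as [Hg _]; split.
  - intros [e [g' [u' [He [_ [_ [Hg'g [Hu' Hd]]]]]]]].
    rewrite <- (mul_unique Hu Hu') in Hd.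
    exact (mul_inverse_r He Hg'g Hd).
  - intro Hd; destruct (inverse_exists Hg) as [e [g' [He [Hg' [Hgg' Hg'g]]]]].
    exists e, g', u.
    exact (conj He (conj Hg' (conj Hgg' (conj Hg'g (conj Hu
      (mul_inverse_r He Hgg' Hd)))))).
Qed.

(** Let [pi] fix an isomorphism [phi] from the group onto a group of bijections
    of [V], and let the restriction [rho] of its action to [V] be one of these
    bijections, say [rho = phi g0].  For [d = pi[c]] we get
    [phi d = pi[phi c] = rho (phi c) rho^-1], that is, [d = g0 c g0^-1]. *)
Lemma act_inner A pi V Y phi rho :
  is_atom_set A -> is_bijection pi A A ->
  isset V -> act pi X X -> act pi V V -> act pi phi phi ->
  is_bijection phi X Y ->
  (forall f, f ∈ Y -> is_bijection f V V) ->
  (forall x y z f g h, mul m x y z ->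
     rel phi x f -> rel phi y g -> rel phi z h -> is_comp h f g) ->
  (forall v w : M, rel rho v w <-> v ∈ V /\ act pi v w) -> rho ∈ Y ->
  is_inner X m (act pi).
Proof.
  intros HA Hpi SV HX HV Hphi Biso HY Hcomp Hrho Yrho.
  pose proof Biso as [Fiso [Riso Siso]].
  destruct (Siso rho Yrho) as [g0 [Hg0 _]].
  pose proof (function_dom Fiso Hg0) as Xg0.
  exists g0; split; [ exact Xg0 | ]; intros c Hc.
  destruct (mul_total Xg0 Hc) as [u [Xu Hu]].
  assert (Key : forall d, act pi c d -> mul m d g0 u).
  { intros d Hd; pose proof (proj1 (act_mem_iff HM HA Hpi HX Hd) Hc) as Xd.
    destruct (mul_total Xd Xg0) as [u' [Xu' Hu']].
    destruct (function_total Fiso Hc) as [g Hg].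
    destruct (function_total Fiso Xd) as [h Hh].
    destruct (function_total Fiso Xu) as [k Hk].
    destruct (function_total Fiso Xu') as [k' Hk'].
    (* As phi is fixed, phi (pi[c]) = pi[phi c]. *)
    assert (Hgh : act pi g h).
    { destruct (act_total HM HA (x := g) Hpi) as [h' Hh'].
      { exact (proj2 (rel_bounded (act_bounded Hphi) Hg)). }
      pose proof (proj1 (act_rel_iff HM HA Hpi Hphi Hd Hh') Hg) as K.
      rewrite (function_unique Fiso Hh K); exact Hh'. }
    pose proof (Hcomp _ _ _ _ _ _ Hu Hg0 Hg Hk) as Ck.
    pose proof (Hcomp _ _ _ _ _ _ Hu' Hh Hg0 Hk') as Ck'.
    pose proof (HY g (Riso _ _ Hg)) as Bg; pose proof (HY h (Riso _ _ Hh)) as Bh.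
    (* rho g = h rho: apply pi to the pairs in g. *)
    assert (E : k = k').
    { apply (@function_ext M HM k k' V V).
      - exact (proj1 (HY k (Riso _ _ Hk))).
      - exact (proj1 (HY k' (Riso _ _ Hk'))).
      - intros x z; rewrite (Ck x z), (Ck' x z); split.
        + intros [y [Hxy Hyz]]; apply Hrho in Hyz as [_ Hyz].
          pose proof (function_dom (proj1 Bg) Hxy) as Vx.
          destruct (act_mem_image HM HV Vx) as [x' [_ Hx']].
          exists x'; split; [ apply Hrho; auto | ].
          exact (proj1 (act_rel_iff HM HA Hpi Hgh Hx' Hyz) Hxy).
        + intros [x' [Hx' Hz]]; apply Hrho in Hx' as [Vx Hx'].
          destruct (act_mem_preimage HV SV (proj1 (proj2 Bh) _ _ Hz))
            as [y [Vy Hy]].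
          exists y; split; [ | apply Hrho; auto ].
          exact (proj2 (act_rel_iff HM HA Hpi Hgh Hx' Hy) Hz). }
    subst k'.
    rewrite (bijection_inj Biso Hk Hk'); exact Hu'. }
  intro d; rewrite (conjugate_iff d Hu); split; [ apply Key | ].
  intro Hd; destruct (act_mem_image HM HX Hc) as [d' [_ Hd']].
  rewrite (mul_cancel_r Hd (Key d' Hd')); exact Hd'.
Qed.

End Groups.

(** * Symmetric and hereditarily symmetric elements *)

Section PermutationModel.
Variable M : set_structure.
Hypothesis HM : is_ZFA M.
Variables A Sigma F : M.
Hypothesis HA : is_atom_set A.
Hypothesis HSigma : is_perm_group A Sigma.
Hypothesis HF : is_normal_filter A Sigma F.
Implicit Types x y z s : M.

Lemma filter_sub Theta s : Theta ∈ F -> s ∈ Theta -> s ∈ Sigma.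
Proof. intros HT; exact (proj1 (nf_subgroup HF HT) s). Qed.

Lemma filter_bijection Theta s : Theta ∈ F -> s ∈ Theta -> is_bijection s A A.
Proof. intros HT Hs; exact (pg_bij HSigma (filter_sub HT Hs)). Qed.

Lemma fixing_refine Theta x : Theta ∈ F ->
  hereditarily_symmetric Sigma F x ->
  exists Theta', Theta' ∈ F /\ subset Theta' Theta /\
    forall s, s ∈ Theta' -> act s x x.
Proof.
  intros HT [[Psi [HPsi [_ Hst]]] _].
  destruct (nf_inter HF HT HPsi) as [Th [HTh [_ Hin]]].
  exists Th; split; [ exact HTh | split ]; intros s Hs; apply Hin in Hs as [H1 H2].
  - exact H1.
  - apply Hst in H2; exact (proj2 H2).
Qed.

Lemma act_inverse_fixed s s' x : s ∈ Sigma -> s' ∈ Sigma -> is_inverse s' s ->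
  act s x x -> act s' x x.
Proof.
  intros Hs Hs' Hinv Hx.
  pose proof (pg_bij HSigma Hs) as Bs; pose proof (pg_bij HSigma Hs') as Bs'.
  destruct (act_total HM HA (x := x) Bs') as [q Hq].
  { exact (act_bounded Hx). }
  destruct (pg_id HSigma) as [i [Hi Hid]].
  pose proof (pg_bij HSigma Hi) as Bi.
  assert (Hc : is_comp i s' s).
  { intros a b; split.
    - intro Hab; apply Hid in Hab as [Aa E]; subst b.
      destruct (function_total (proj1 Bs) Aa) as [y Hy].
      exists y; split; [ | apply Hinv ]; exact Hy.
    - intros [y [Hay Hyb]]; apply Hinv in Hyb.
      apply Hid; split; [ exact (function_dom (proj1 Bs) Hay) | ].
      exact (bijection_inj Bs Hay Hyb). }
  pose proof (act_comp HM HA Bi Bs' Bs Hc Hx Hq) as Hiq.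
  rewrite <- (act_unique HM HA Bi (act_id HM HA Bi Hid (act_bounded Hx)) Hiq) in Hq.
  exact Hq.
Qed.

(** The stabilizer is a subgroup, and the filter is closed under supergroups, so
    it suffices that some member of the filter is included in the stabilizer. *)
Lemma symmetric_intro Theta x : Theta ∈ F ->
  (forall s, s ∈ Theta -> act s x x) -> symmetric Sigma F x.
Proof.
  intros HT Hfix.
  destruct (separation HM (P := fun s e => act s (e 0) (e 0)) (env1 x) Sigma)
    as [Psi [SPsi HPsi]].
  { definability. }
  unfold env1 in HPsi.
  exists Psi; split; [ | split; trivial ].
  apply (nf_up HF HT).
  - split; [ intros s Hs; apply HPsi in Hs; tauto | split ].
    + exact SPsi.
    + intros s Hs; apply HPsi in Hs; exact (pg_bij HSigma (proj1 Hs)).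
    + destruct (pg_id (proj2 (nf_subgroup HF HT))) as [i [Hi Hid]].
      exists i; split; trivial; apply HPsi; split;
        [ exact (filter_sub HT Hi) | exact (Hfix i Hi) ].
    + intros s t Hs Ht; apply HPsi in Hs as [Hs Hsx], Ht as [Ht Htx].
      destruct (pg_comp HSigma Hs Ht) as [r [Hr Hc]].
      exists r; split; trivial; apply HPsi; split; trivial.
      exact (act_comp HM HA (pg_bij HSigma Hr) (pg_bij HSigma Hs)
        (pg_bij HSigma Ht) Hc Htx Hsx).
    + intros s Hs; apply HPsi in Hs as [Hs Hsx].
      destruct (pg_inv HSigma Hs) as [r [Hr Hinv]].
      exists r; split; trivial; apply HPsi; split; trivial.
      exact (act_inverse_fixed Hs Hr Hinv Hsx).
  - intros s Hs; apply HPsi; split; [ exact (filter_sub HT Hs) | exact (Hfix s Hs) ].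
Qed.

Notation HS := (hereditarily_symmetric Sigma F).

Lemma HS_mem x y : HS x -> y ∈ x -> HS y.
Proof.
  intros [_ [T [[ST [HT [HxT _]]] Hsym]]] Hy; split; [ exact (Hsym y (HxT y Hy)) | ].
  destruct (tc_exists HM HT (x := y)) as [U [HU HUT]].
  { exact (HT y (HxT y Hy)). }
  exists U; split; trivial; intros z Hz; exact (Hsym z (HUT z Hz)).
Qed.

(** The hull is the union of [x] with the transitive closures of its elements,
    which replacement collects because they are unique. *)
Lemma HS_hull x : (forall u, u ∈ x -> HS u) ->
  exists T, transitive T /\ subset x T /\ forall z, z ∈ T -> symmetric Sigma F z.
Proof.
  intro Hx.
  destruct (replacement HM (R := fun u t _ => is_tc t u) (e := env1 x) (x := x))
    as [C [_ HC]].
  { definability. }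
  { intros u v v' _; exact (@tc_unique M HM v v' u). }
  destruct (zfa_union HM C) as [W [_ HW]].
  destruct (union2_exists HM x W) as [T [_ HT]].
  assert (Htc : forall u z, u ∈ x -> z ∈ u -> z ∈ W).
  { intros u z Hu Hz; destruct (proj2 (Hx u Hu)) as [t [Ht _]].
    apply HW; exists t; split; [ apply HC; exists u; auto | ].
    exact (proj1 (proj2 (proj2 Ht)) z Hz). }
  exists T; split; [ | split ].
  - intros y Hy z Hz; apply HT; right; apply HT in Hy as [Hy|Hy].
    + exact (Htc y z Hy Hz).
    + apply HW in Hy as [t [Ht Hyt]]; apply HW; exists t; split; trivial.
      apply HC in Ht as [u [_ [_ [Tt _]]]]; exact (Tt y Hyt z Hz).
  - intros z Hz; apply HT; auto.
  - intros z Hz; apply HT in Hz as [Hz|Hz]; [ apply (Hx z Hz) | ].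
    apply HW in Hz as [t [Ht Hzt]]; apply HC in Ht as [u [Hu Ht]].
    destruct (proj2 (Hx u Hu)) as [t' [Ht' Hsym]].
    rewrite (tc_unique HM Ht Ht') in Hzt; exact (Hsym z Hzt).
Qed.

(** The images in the last hypothesis always exist, since [x] is included in a
    transitive set; so only the value of the action has to be checked. *)
Lemma HS_intro Theta x : (forall u, u ∈ x -> HS u) -> Theta ∈ F ->
  (forall s y, s ∈ Theta -> act s x y -> x = y) -> HS x.
Proof.
  intros Hx HT Hfix; destruct (HS_hull Hx) as [T [TT [HxT Hsym]]]; split.
  - apply (symmetric_intro HT); intros s Hs.
    destruct (act_total HM HA (filter_bijection HT Hs)
      (bounded_subset HM TT HxT)) as [y Hy].
    rewrite <- (Hfix s y Hs Hy) in Hy; exact Hy.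
  - destruct (tc_exists HM TT HxT) as [U [HU HUT]].
    exists U; split; trivial; intros z Hz; exact (Hsym z (HUT z Hz)).
Qed.

Lemma HS_upair p x y : is_upair p x y -> HS x -> HS y -> HS p.
Proof.
  intros Hp Hx Hy.
  destruct (fixing_refine (nf_top HF) Hx) as [T1 [HT1 [_ F1]]].
  destruct (fixing_refine HT1 Hy) as [T2 [HT2 [S2 F2]]].
  apply (@HS_intro T2); trivial.
  - intros u Hu; apply Hp in Hu as [E|E]; subst; trivial.
  - intros s q Hs Hq; pose proof (filter_bijection HT2 Hs) as Bs.
    exact (act_unique HM HA Bs
      (act_upair HM HA Bs Hp Hp (F1 s (S2 s Hs)) (F2 s Hs)) Hq).
Qed.

Lemma HS_opair p x y : is_opair p x y -> HS x -> HS y -> HS p.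
Proof.
  intros [a [b [Ha [Hb Hp]]]] Hx Hy.
  exact (HS_upair Hp (HS_upair Ha Hx Hx) (HS_upair Hb Hx Hy)).
Qed.

Lemma HS_opair_inv p x y : is_opair p x y -> HS p -> HS x /\ HS y.
Proof.
  intros [a [b [_ [Hb Hp]]]] H.
  assert (HSb : HS b) by (apply (HS_mem H); apply Hp; auto).
  split; apply (HS_mem HSb); apply Hb; auto.
Qed.

Lemma HS_rel_inv r x y : HS r -> rel r x y -> HS x /\ HS y.
Proof. intros Hr [p [Hp Hxy]]; exact (HS_opair_inv Hxy (HS_mem Hr Hp)). Qed.

(** If [s[pi] = pi], then [s] and [pi] commute as permutations of the atoms.
    Both composites then act in the same way, so [s] maps the graph of the action
    of [pi] to itself. *)
Lemma act_commutes_of_fixed s pi v w v' w' : s ∈ Sigma -> pi ∈ Sigma ->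
  act s pi pi -> act pi v w -> act s v v' -> act s w w' -> bounded v' -> act pi v' w'.
Proof.
  intros Hs Hpi Hfix Hvw Hv Hw Bv'.
  pose proof (pg_bij HSigma Hs) as Bs; pose proof (pg_bij HSigma Hpi) as Bpi.
  destruct (pg_comp HSigma Hs Hpi) as [r [Hr Hc]].
  pose proof (pg_bij HSigma Hr) as Br.
  assert (Hc' : is_comp r pi s).
  { assert (Hrel : forall a b a' b', rel s a a' -> rel s b b' ->
      (rel pi a b <-> rel pi a' b')).
    { intros a b a' b' Ha Hb.
      exact (act_rel_iff HM HA Bs Hfix (act_of_atom HM HA Bs Ha)
        (act_of_atom HM HA Bs Hb)). }
    intros a c; rewrite (Hc a c); split.
    - intros [b [Hab Hbc]].
      destruct (function_total (proj1 Bs) (function_dom (proj1 Bpi) Hab)) as [a' Ha].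
      exists a'; split; trivial; exact (proj1 (Hrel a b a' c Ha Hbc) Hab).
    - intros [a' [Ha Hac]].
      destruct (proj2 (proj2 Bs) c (proj1 (proj2 Bpi) _ _ Hac)) as [b [Hb _]].
      exists b; split; trivial; exact (proj2 (Hrel a b a' c Ha Hb) Hac). }
  pose proof (act_comp HM HA Br Bs Bpi Hc Hvw Hw) as H1.
  destruct (act_total HM HA Bpi Bv') as [q Hq].
  pose proof (act_comp HM HA Br Bpi Bs Hc' Hv Hq) as H2.
  rewrite (act_unique HM HA Br H1 H2); exact Hq.
Qed.

Lemma restricted_action_exists s x : act s x x -> is_bijection s A A ->
  exists r, isset r /\
    (forall p, p ∈ r -> exists y z, y ∈ x /\ is_opair p y z) /\
    forall y z, rel r y z <-> y ∈ x /\ act s y z.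
Proof.
  intros [T [f [Hact [HxT _]]]] Bs.
  pose proof Hact as [HT [Hf _]].
  assert (Hfact : forall y z, y ∈ x -> (rel f y z <-> act s y z)).
  { intros y z Hy; pose proof (HT x HxT y Hy) as Ty.
    destruct (function_total Hf Ty) as [w Hw].
    assert (Aw : act s y w) by (exists T, f; auto).
    split; intro H.
    - exists T, f; auto.
    - rewrite (act_unique HM HA Bs H Aw); exact Hw. }
  destruct (separation HM
    (P := fun p e => exists y z, y ∈ e 0 /\ is_opair p y z) (env1 x) f)
    as [r [Sr Hr]].
  { definability. }
  unfold env1 in Hr.
  exists r; split; [ exact Sr | split ].
  - intros p Hp; apply Hr in Hp; tauto.
  - intros y z; split.
    + intros [p [Hp Hyz]]; apply Hr in Hp as [Hp [y0 [z0 [Hy0 H0]]]].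
      destruct (opair_inj Hyz H0); subst y0 z0.
      split; trivial; apply Hfact; trivial; exists p; auto.
    + intros [Hy Hyz]; apply (Hfact y z Hy) in Hyz as [p [Hp Hpyz]].
      exists p; split; trivial; apply Hr; split; trivial; exists y, z; auto.
Qed.

(** The graph of the action of [pi] on [V] is fixed by every permutation that
    fixes both [pi] and [V].  This is where [pi] has to belong to the permutation
    model. *)
Lemma HS_restricted_action pi V r : pi ∈ Sigma -> HS pi -> HS V -> isset V ->
  act pi V V -> isset r ->
  (forall p, p ∈ r -> exists y z, y ∈ V /\ is_opair p y z) ->
  (forall y z, rel r y z <-> y ∈ V /\ act pi y z) -> HS r.
Proof.
  intros Hpi HSpi HSV SV HV Sr Hpair Hr.
  pose proof (pg_bij HSigma Hpi) as Bpi.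
  destruct (fixing_refine (nf_top HF) HSpi) as [T1 [HT1 [_ F1]]].
  destruct (fixing_refine HT1 HSV) as [T2 [HT2 [S2 F2]]].
  apply (@HS_intro T2); trivial.
  - intros p Hp; destruct (Hpair p Hp) as [y [z [Hy Hyz]]].
    apply (HS_opair Hyz); apply (HS_mem HSV); trivial.
    assert (Hr' : rel r y z) by (exists p; auto).
    apply Hr in Hr' as [_ Hr']; exact (proj1 (act_mem_iff HM HA Bpi HV Hr') Hy).
  - intros s q Hs Hq; pose proof (filter_bijection HT2 Hs) as Bs.
    pose proof (filter_sub HT2 Hs) as Ss.
    assert (Key : forall v w v' w', act s v v' -> act s w w' ->
      (rel r v w <-> rel r v' w')).
    { intros v w v' w' Av Aw.
      pose proof (act_mem_iff HM HA Bs (F2 s Hs) Av) as HvV.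
      rewrite (Hr v w), (Hr v' w'), HvV; split; intros [Hv' Hvw]; split; trivial.
      - apply (@act_commutes_of_fixed s pi v w v' w' Ss Hpi (F1 s (S2 s Hs)) Hvw Av Aw).
        exact (mem_bounded (act_bounded HV) Hv').
      - destruct (act_mem_image HM HV (proj2 HvV Hv')) as [w0 [Hw0 Hvw0]].
        destruct (act_mem_image HM (F2 s Hs) Hw0) as [w0' [_ Aw0]].
        pose proof (act_commutes_of_fixed Ss Hpi (F1 s (S2 s Hs)) Hvw0 Av Aw0
          (mem_bounded (act_bounded HV) Hv')) as Hvw0'.
        pose proof (act_unique HM HA Bpi Hvw Hvw0') as E; subst w0'.
        rewrite (proj2 (act_eq_iff HM HA Bs Aw Aw0) eq_refl); exact Hvw0. }
    apply (zfa_extensionality HM Sr (act_isset Hq Sr)); intro p; split; intro Hp.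
    + destruct (Hpair p Hp) as [v' [w' [Hv' Hp']]].
      assert (Hr' : rel r v' w') by (exists p; auto).
      pose proof (proj1 (Hr _ _) Hr') as [_ Hvw'].
      pose proof (proj1 (act_mem_iff HM HA Bpi HV Hvw') Hv') as Hw'.
      destruct (act_mem_preimage (F2 s Hs) SV Hv') as [v [Hv Av]].
      destruct (act_mem_preimage (F2 s Hs) SV Hw') as [w [Hw Aw]].
      apply (mem_rel HM q Hp'), (act_rel_iff HM HA Bs Hq Av Aw).
      apply (Key _ _ _ _ Av Aw); exact Hr'.
    + destruct (act_mem_preimage Hq Sr Hp) as [p0 [Hp0 Ap]].
      destruct (Hpair p0 Hp0) as [v [w [Hv Hvw]]].
      assert (Hrvw : rel r v w) by (exists p0; auto).
      pose proof (proj1 (Hr _ _) Hrvw) as [_ Avw].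
      pose proof (proj1 (act_mem_iff HM HA Bpi HV Avw) Hv) as Hw.
      destruct (act_mem_image HM (F2 s Hs) Hv) as [v' [_ Av]].
      destruct (act_mem_image HM (F2 s Hs) Hw) as [w' [_ Aw]].
      destruct (opair_exists HM v' w') as [p' Hp'].
      rewrite (act_unique HM HA Bs Ap (act_opair HM HA Bs Hvw Hp' Av Aw)).
      apply (mem_rel HM r Hp'), (Key _ _ _ _ Av Aw); exact Hrvw.
Qed.

(** * Absoluteness *)

(** Every element of a hereditarily symmetric element is hereditarily symmetric,
    so notions whose quantifiers are bounded by elements of the model mean the
    same in the permutation model [N] as in [M]. *)
Notation N := (perm_model Sigma F).

Lemma incl_inj (x y : N) : incl x = incl y -> x = y.
Proof.
  destruct x as [x Hx], y as [y Hy]; simpl; intro E; subst y.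
  rewrite (proof_irrelevance _ Hx Hy); reflexivity.
Qed.

Lemma HS_incl (x : N) : HS (incl x).
Proof. exact (proj2_sig x). Qed.

Lemma HS_lift x : HS x -> exists x' : N, x = incl x'.
Proof. intro Hx; exists (exist _ x Hx); reflexivity. Qed.

Lemma mem_lift x (y : N) : x ∈ incl y -> exists x' : N, x = incl x'.
Proof. intro Hx; exact (HS_lift (HS_mem (HS_incl y) Hx)). Qed.

Lemma upair_abs (p x y : N) :
  is_upair p x y <-> is_upair (incl p) (incl x) (incl y).
Proof.
  split; intros [Sp Hp]; split; try exact Sp; intro z.
  - split.
    + intro Hz; destruct (mem_lift Hz) as [z' E]; subst z.
      apply (Hp z') in Hz as [E|E]; subst; auto.
    + intros [E|E]; subst z; [ apply (Hp x) | apply (Hp y) ]; auto.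
  - split.
    + intro Hz; apply (Hp (incl z)) in Hz as [E|E]; apply incl_inj in E; auto.
    + intros [E|E]; subst z; apply (Hp _); auto.
Qed.

Lemma opair_abs (p x y : N) :
  is_opair p x y <-> is_opair (incl p) (incl x) (incl y).
Proof.
  split.
  - intros [a [b [Ha [Hb Hp]]]]; exists (incl a), (incl b).
    rewrite <- !upair_abs; auto.
  - intros [a [b [Ha [Hb Hp]]]].
    destruct (@mem_lift a p) as [a' E]; [ apply Hp; auto | subst a ].
    destruct (@mem_lift b p) as [b' E]; [ apply Hp; auto | subst b ].
    exists a', b'; rewrite !upair_abs; auto.
Qed.

Lemma rel_abs (r x y : N) : rel r x y <-> rel (incl r) (incl x) (incl y).
Proof.
  split.
  - intros [p [Hp Hxy]]; exists (incl p); split; [ exact Hp | now apply opair_abs ].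
  - intros [p [Hp Hxy]]; destruct (mem_lift Hp) as [p' E]; subst p.
    exists p'; split; [ exact Hp | now apply opair_abs ].
Qed.

Lemma rel_lift (r : N) x y : rel (incl r) x y ->
  exists x' y' : N, x = incl x' /\ y = incl y' /\ rel r x' y'.
Proof.
  intro H; destruct (HS_rel_inv (HS_incl r) H) as [Hx Hy].
  destruct (HS_lift Hx) as [x' Ex], (HS_lift Hy) as [y' Ey]; subst.
  exists x', y'; repeat split; now apply rel_abs.
Qed.

Lemma triple_abs (p x y z : N) :
  is_triple p x y z <-> is_triple (incl p) (incl x) (incl y) (incl z).
Proof.
  split; intros [q [Hq Hp]].
  - exists (incl q); now rewrite <- !opair_abs.
  - destruct (HS_lift (proj1 (HS_opair_inv Hp (HS_incl p)))) as [q' E]; subst q.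
    exists q'; now rewrite !opair_abs.
Qed.

Lemma mul_abs (m x y z : N) :
  mul m x y z <-> mul (incl m) (incl x) (incl y) (incl z).
Proof.
  split; intros [p [Hp Ht]].
  - exists (incl p); split; [ exact Hp | now apply triple_abs ].
  - destruct (mem_lift Hp) as [p' E]; subst p.
    exists p'; split; [ exact Hp | now apply triple_abs ].
Qed.

Lemma mul_lift (m : N) x y z : mul (incl m) x y z ->
  exists x' y' z' : N, x = incl x' /\ y = incl y' /\ z = incl z' /\ mul m x' y' z'.
Proof.
  intro H; pose proof H as [p [Hp [q [Hq Hpq]]]].
  destruct (HS_opair_inv Hpq (HS_mem (HS_incl m) Hp)) as [HSq HSz].
  destruct (HS_opair_inv Hq HSq) as [HSx HSy].
  destruct (HS_lift HSx) as [x' Ex], (HS_lift HSy) as [y' Ey], (HS_lift HSz) as [z' Ez].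
  subst; exists x', y', z'; repeat split; now apply mul_abs.
Qed.

Lemma function_abs (f X : N) : is_function f X <-> is_function (incl f) (incl X).
Proof.
  split; intros [Sf [Hp Hx]]; (split; [ exact Sf | split ]).
  - intros p Hpf; destruct (mem_lift Hpf) as [p' E]; subst p.
    destruct (Hp p' Hpf) as [x [y [Xx Hxy]]].
    exists (incl x), (incl y); split; [ exact Xx | now apply opair_abs ].
  - intros x Xx; destruct (mem_lift Xx) as [x' E]; subst x.
    destruct (Hx x' Xx) as [y [Hy Uy]]; exists (incl y).
    split; [ now apply rel_abs | ].
    intros w Hw; destruct (rel_lift Hw) as [x1 [y1 [Ex [Ey Hw1]]]].
    apply incl_inj in Ex; subst; now rewrite (Uy y1 Hw1).
  - intros p Hpf; destruct (Hp (incl p) Hpf) as [x [y [Xx Hxy]]].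
    destruct (HS_opair_inv Hxy (HS_incl p)) as [HSx HSy].
    destruct (HS_lift HSx) as [x' Ex], (HS_lift HSy) as [y' Ey]; subst.
    exists x', y'; split; [ exact Xx | now apply opair_abs ].
  - intros x Xx; destruct (Hx (incl x) Xx) as [y [Hy Uy]].
    destruct (rel_lift Hy) as [x1 [y1 [Ex [Ey Hw1]]]].
    apply incl_inj in Ex; subst; exists y1; split; [ exact Hw1 | ].
    intros w Hw; apply incl_inj, Uy; now apply rel_abs.
Qed.

Lemma bijection_abs (f X Y : N) :
  is_bijection f X Y <-> is_bijection (incl f) (incl X) (incl Y).
Proof.
  split; intros [Hf [HY Hs]];
    (split; [ now apply function_abs | split ]).
  - intros x y H; destruct (rel_lift H) as [x' [y' [Ex [Ey H']]]]; subst.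
    exact (HY x' y' H').
  - intros y Yy; destruct (mem_lift Yy) as [y' E]; subst y.
    destruct (Hs y' Yy) as [x [Hx Ux]]; exists (incl x).
    split; [ now apply rel_abs | ].
    intros w Hw; destruct (rel_lift Hw) as [x1 [y1 [Ex [Ey Hw1]]]].
    apply incl_inj in Ey; subst; now rewrite (Ux x1 Hw1).
  - intros x y H; apply (HY (incl x) (incl y)); now apply rel_abs.
  - intros y Yy; destruct (Hs (incl y) Yy) as [x [Hx Ux]].
    destruct (rel_lift Hx) as [x1 [y1 [Ex [Ey Hw1]]]].
    apply incl_inj in Ey; subst; exists x1; split; [ exact Hw1 | ].
    intros w Hw; apply incl_inj, Ux; now apply rel_abs.
Qed.

Lemma comp_incl (h f g : N) :
  is_comp h f g -> is_comp (incl h) (incl f) (incl g).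
Proof.
  intros Hc x z; split.
  - intro H; destruct (rel_lift H) as [x' [z' [Ex [Ez H']]]]; subst.
    apply Hc in H' as [y [Hg Hf]]; exists (incl y).
    split; now apply rel_abs.
  - intros [y [Hg Hf]].
    destruct (rel_lift Hg) as [x' [y' [Ex [Ey Hg']]]].
    destruct (rel_lift Hf) as [y1 [z' [Ey1 [Ez Hf']]]]; subst.
    apply incl_inj in Ey1; subst y1.
    apply rel_abs, Hc; exists y'; auto.
Qed.

Lemma group_incl (Gamma X m : N) :
  is_group Gamma X m -> is_group (incl Gamma) (incl X) (incl m).
Proof.
  intros [Hp HX Hm Hgr Htot Hass [e [[Xe He] Hinv]]]; split.
  - now apply opair_abs.
  - exact HX.
  - exact Hm.
  - intros p Hpm; destruct (mem_lift Hpm) as [p' E]; subst p.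
    destruct (Hgr p' Hpm) as [x [y [z [Hx [Hy [Hz Ht]]]]]].
    exists (incl x), (incl y), (incl z).
    exact (conj Hx (conj Hy (conj Hz (proj1 (triple_abs _ _ _ _) Ht)))).
  - intros x y Hx Hy.
    destruct (mem_lift Hx) as [x' Ex], (mem_lift Hy) as [y' Ey]; subst.
    destruct (Htot x' y' Hx Hy) as [z [Hz Uz]]; exists (incl z).
    split; [ now apply mul_abs | ].
    intros w Hw; destruct (mul_lift Hw) as [x1 [y1 [z1 [Ex [Ey [Ez Hw']]]]]].
    apply incl_inj in Ex, Ey; subst; now rewrite (Uz z1 Hw').
  - intros x y z xy yz w Hx Hy Hz Hxy Hyz.
    destruct (mul_lift Hxy) as [x' [y' [xy' [Ex [Ey [Exy Hxy']]]]]].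
    destruct (mul_lift Hyz) as [y1 [z' [yz' [Ey1 [Ez [Eyz Hyz']]]]]]; subst.
    apply incl_inj in Ey1; subst y1.
    split; intro H; destruct (mul_lift H) as [a [b [w' [Ea [Eb [Ew H']]]]]];
      apply incl_inj in Ea, Eb; subst a b w; apply mul_abs;
      apply (Hass x' y' z' xy' yz' w' Hx Hy Hz Hxy' Hyz'); exact H'.
  - exists (incl e); split; [ split; [ exact Xe | ] | ].
    + intros x Hx; destruct (mem_lift Hx) as [x' Ex]; subst.
      rewrite <- !mul_abs; exact (He x' Hx).
    + intros x Hx; destruct (mem_lift Hx) as [x' Ex]; subst.
      destruct (Hinv x' Hx) as [y [Hy Hxy]]; exists (incl y).
      rewrite <- !mul_abs; auto.
Qed.

(** A permutation that fixes the vertices and the edges acts on the graph by an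
    automorphism, as its action commutes with forming pairs. *)
Lemma action_automorphism (V E r : N) pi : is_bijection pi A A ->
  isset (incl V) -> isset (incl r) ->
  act pi (incl V) (incl V) -> act pi (incl E) (incl E) ->
  (forall p, p ∈ incl r -> exists y z, y ∈ incl V /\ is_opair p y z) ->
  (forall y z, rel (incl r) y z <-> y ∈ incl V /\ act pi y z) ->
  is_automorphism V E r.
Proof.
  intros Bpi SV Sr HV HE Hpair Hr; split.
  - apply bijection_abs; split; [ split; [ exact Sr | split ] | split ].
    + exact Hpair.
    + intros v Hv; destruct (act_mem_image HM HV Hv) as [w [_ Hw]].
      exists w; split; [ apply Hr; auto | ].
      intros w' Hw'; apply Hr in Hw'; exact (act_unique HM HA Bpi Hw (proj2 Hw')).
    + intros v w H; apply Hr in H as [Hv H].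
      exact (proj1 (act_mem_iff HM HA Bpi HV H) Hv).
    + intros w Hw; destruct (act_mem_preimage HV SV Hw) as [v [Hv H]].
      exists v; split; [ apply Hr; auto | ].
      intros v' H'; apply Hr in H'.
      exact (proj2 (act_eq_iff HM HA Bpi H (proj2 H')) eq_refl).
  - intros x y x' y' _ _ Hx Hy; rewrite !rel_abs.
    apply rel_abs, Hr in Hx as [_ Hx]; apply rel_abs, Hr in Hy as [_ Hy].
    exact (act_rel_iff HM HA Bpi HE Hx Hy).
Qed.

End PermutationModel.

Theorem theorem4 (M : set_structure) (HM : is_ZFA M)
  (A Sigma F : M)
  (HA : is_atom_set A)
  (HSigma : is_perm_group A Sigma)
  (HF : is_normal_filter A Sigma F)
  (Gamma X m : perm_model Sigma F)
  (HGamma : is_group Gamma X m)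
  (Hinner : forall Phi : M, mem Phi F ->
     (forall s : M, mem s Phi -> in_stab Sigma (incl Gamma) s) ->
     exists pi : M, mem pi Phi /\ hereditarily_symmetric Sigma F pi /\
       ~ is_inner (incl X) (incl m) (act pi)) :
  ~ exists G V E : perm_model Sigma F,
      is_graph G V E /\
      exists B Y n : perm_model Sigma F,
        is_aut_group V E B Y n /\ isomorphic_groups X m Y n.
Proof.
  intros [G [V [E [HG [B [Y [n [HB [phi [Bphi Hmul]]]]]]]]]].
  destruct HB as [_ [_ [HY [_ Hn]]]].
  pose proof (gr_vertices HG) as SV.
  destruct (fixing_refine HF (nf_top HF) (HS_incl Gamma)) as [T1 [HT1 [_ F1]]].
  destruct (fixing_refine HF HT1 (HS_incl X)) as [T2 [HT2 [S2 F2]]].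
  destruct (fixing_refine HF HT2 (HS_incl V)) as [T3 [HT3 [S3 F3]]].
  destruct (fixing_refine HF HT3 (HS_incl E)) as [T4 [HT4 [S4 F4]]].
  destruct (fixing_refine HF HT4 (HS_incl phi)) as [T5 [HT5 [S5 F5]]].
  destruct (Hinner T5 HT5) as [pi [Hpi [HSpi Hnot]]].
  { intros s Hs; split; [ exact (filter_sub HF HT5 Hs) |
    exact (F1 s (S2 s (S3 s (S4 s (S5 s Hs))))) ]. }
  apply Hnot; clear Hnot Hinner.
  pose proof (filter_sub HF HT5 Hpi) as Spi.
  pose proof (pg_bij HSigma Spi) as Bpi.
  pose proof (F2 pi (S3 pi (S4 pi (S5 pi Hpi)))) as HX.
  pose proof (F3 pi (S4 pi (S5 pi Hpi))) as HV.
  pose proof (F4 pi (S5 pi Hpi)) as HE.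
  pose proof (F5 pi Hpi) as Hphi.
  destruct (restricted_action_exists HM HA HV Bpi) as [r [Sr [Hpair Hr]]].
  destruct (HS_lift (HS_restricted_action HM HA HSigma HF Spi HSpi
    (HS_incl V) SV HV Sr Hpair Hr)) as [rho Erho]; subst r.
  apply (@act_inner M HM (incl Gamma) (incl X) (incl m)) with
    (A := A) (V := incl V) (Y := incl Y) (phi := incl phi) (rho := incl rho); auto.
  - exact (group_incl HM HGamma).
  - exact (proj1 (bijection_abs HM phi X Y) Bphi).
  - intros f Hf; destruct (mem_lift HM Hf) as [f' Ef]; subst f.
    exact (proj1 (bijection_abs HM f' V V) (proj1 (proj1 (HY f') Hf))).
  - intros x y z f g h Hxyz Hx Hy Hz.
    destruct (mul_lift HM Hxyz) as [x' [y' [z' [Ex [Ey [Ez Hxyz']]]]]].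
    destruct (rel_lift HM Hx) as [x1 [f' [Ex1 [Ef Hx']]]].
    destruct (rel_lift HM Hy) as [y1 [g' [Ey1 [Eg Hy']]]].
    destruct (rel_lift HM Hz) as [z1 [h' [Ez1 [Eh Hz']]]]; subst.
    apply incl_inj in Ex1, Ey1, Ez1; subst x1 y1 z1.
    apply (comp_incl HM).
    destruct (Hmul x' y' z' f' g' h' (function_dom (proj1 Bphi) Hx')
      (function_dom (proj1 Bphi) Hy') Hxyz' Hx' Hy' Hz') as [p [Hp Ht]].
    apply Hn in Hp as [f1 [g1 [h1 [_ [_ [_ [Ht' Hc]]]]]]].
    destruct (triple_inj Ht Ht') as [Ef [Eg Eh]]; subst; exact Hc.
  - apply HY.
    exact (action_automorphism HM HA Bpi SV Sr HV HE Hpair Hr).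
Qed.
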